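(* Let $X$ be a Hadamard space, $C\subseteq X$ closed and convex, $\alpha>1$, and let $T:C\to C$ be an $\alpha$-Lipschitz, demiclosed, quasi-nonexpansive mapping. Let $\{\lambda_k\}$ be a sequence with $0<\lambda_k<\frac1{\alpha-1}$ for all $k$ and $\liminf_k\lambda_k>0$. If $x_0\in C$ and $x_{k+1}=J^T_{\lambda_k}x_k$ for $k\ge 0$, then $\{x_k\}$ $\Delta$-converges to an element of $F(T)$.
   Context: A Hadamard space is a complete CAT(0) space. $(1-t)x\oplus ty$ denotes the unique point $z$ of the geodesic segment $[x,y]$ with $d(x,z)=t\,d(x,y)$ and $d(y,z)=(1-t)d(x,y)$. For a bounded sequence $\{x_k\}$ the asymptotic center is the set of minimizers over $x\in X$ of $\limsup_k d(x,x_k)$. $\{x_k\}$ $\Delta$-converges to $x$ if every subsequence of $\{x_k\}$ has asymptotic center $\{x\}$. $F(T)=\{x\in C:Tx=x\}$. $T$ is $\alpha$-Lipschitz if $d(Tx,Ty)\le\alpha d(x,y)$ for all $x,y\in C$. $T$ is quasi-nonexpansive if $F(T)\neq\varnothing$ and $d(Tx,q)\le d(x,q)$ for all $x\in C$, $q\in F(T)$. $T$ is demiclosed if, whenever $\{x_k\}\subset C$ $\Delta$-converges to $x$ and $d(x_k,Tx_k)\to0$, one has $x\in F(T)$. For $0<\lambda<\frac1{\alpha-1}$ and $x\in C$, the map $y\mapsto\frac1{1+\lambda}x\oplus\frac{\lambda}{1+\lambda}Ty$ is a contraction of $C$; its unique fixed point is denoted $J^T_\lambda x$ (the resolvent), so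 $J^T_\lambda x=\frac1{1+\lambda}x\oplus\frac{\lambda}{1+\lambda}T(J^T_\lambda x)$. *)

(* Defs.v *)
From HB Require Import structures.
From mathcomp Require Import all_boot all_order all_algebra.
From mathcomp Require Import all_classical all_reals all_analysis.

Set Implicit Arguments.
Unset Strict Implicit.
Unset Printing Implicit Defensive.

Import Order.TTheory GRing.Theory Num.Theory.
Import numFieldNormedType.Exports.

Local Open Scope classical_set_scope.
Local Open Scope ring_scope.

Section euclidean_plane.
Context {R : realType}.

(* The library norm on row vectors is the sup norm, hence this definition. *)
Definition eucl_dist (u v : 'rV[R]_2) : R :=
  Num.sqrt (\sum_(i < 2) (u ord0 i - v ord0 i) ^+ 2).

Definition eucl_segment (u v : 'rV[R]_2) : set 'rV[R]_2 :=
  [set (1 - t) *: u + t *: v | t in `[0, 1]].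

End euclidean_plane.

Section hadamard_spaces.
Context {R : realType} {X : metricType R}.
Implicit Types (x y p q r : X) (S : set X).

(* The domain of a geodesic from x to y is an interval [0, l]; being an
   isometric embedding forces l = d(x, y). Values of c outside are irrelevant. *)
Definition geodesic_path (c : R -> X) x y : Prop :=
  [/\ c 0 = x, c (mdist x y) = y &
      {in `[0, mdist x y] &, forall s t, mdist (c s) (c t) = `|s - t|}].

Definition geodesic_segment S x y : Prop :=
  exists2 c, geodesic_path c x y & S = c @` `[0, mdist x y].

(* x' is the comparison point, on the Euclidean segment [p', q'], of the point
   x of the geodesic segment S from p to q. *)
Definition comparison_point S p q (p' q' : 'rV[R]_2) x (x' : 'rV[R]_2) : Prop :=
  [/\ geodesic_segment S p q, S x, eucl_segment p' q' x' &
      eucl_dist p' x' = mdist p x].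

(* Every geodesic triangle, with sides Spq, Sqr, Srp, is at least as thin as
   its comparison triangles in the Euclidean plane. *)
Definition cat0_inequality : Prop :=
  forall p q r (Spq Sqr Srp : set X) (p' q' r' : 'rV[R]_2),
    geodesic_segment Spq p q -> geodesic_segment Sqr q r ->
    geodesic_segment Srp r p ->
    eucl_dist p' q' = mdist p q -> eucl_dist q' r' = mdist q r ->
    eucl_dist r' p' = mdist r p ->
  let comparison (x : X) (x' : 'rV[R]_2) : Prop :=
    [\/ comparison_point Spq p q p' q' x x',
        comparison_point Sqr q r q' r' x x' |
        comparison_point Srp r p r' p' x x'] in
  forall x y (x' y' : 'rV[R]_2), comparison x x' -> comparison y y' ->
    mdist x y <= eucl_dist x' y'.

Definition geodesic_convex (C : set X) : Prop :=
  forall x y S, C x -> C y -> geodesic_segment S x y -> S `<=` C.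

(* (1 - t) x (+) t y, for t in [0, 1]; the default value of xget is never used
   in a CAT(0) space, where this point exists and is unique. *)
Definition oplus (t : R) x y : X :=
  xget x [set z | exists S, [/\ geodesic_segment S x y, S z,
    mdist x z = t * mdist x y & mdist y z = (1 - t) * mdist x y]].

Definition bounded_sequence (u : nat -> X) : Prop :=
  exists a M, forall k, mdist a (u k) <= M.

Definition asymptotic_center (u : nat -> X) : set X :=
  [set x | forall y, (limn_esup (fun k => (mdist x (u k))%:E) <=
                      limn_esup (fun k => (mdist y (u k))%:E))%E].

Definition delta_cvg (u : nat -> X) x : Prop :=
  bounded_sequence u /\
  forall phi : nat -> nat, {homo phi : m n / (m < n)%N} ->
    asymptotic_center (u \o phi) = [set x].

End hadamard_spaces.

Definition geodesic_space {R : realType} (X : metricType R) : Prop :=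
  forall x y : X, exists c : R -> X, geodesic_path c x y.

Definition cat0_space {R : realType} (X : metricType R) : Prop :=
  geodesic_space X /\ @cat0_inequality R X.

(* completeType is not used because it requires a distinguished point. *)
Definition complete_metric {R : realType} (X : metricType R) : Prop :=
  forall u : nat -> X, cauchy (u @ \oo) -> exists l : X, u @ \oo --> l.

Definition hadamard_space {R : realType} (X : metricType R) : Prop :=
  complete_metric X /\ cat0_space X.

(* A mapping T : C -> C is a total T : X -> X that maps C to C; none of the
   notions below depends on the values of T outside C. *)
Section mappings.
Context {R : realType} {X : metricType R}.
Variables (C : set X) (T : X -> X).

Definition fixed_points : set X := [set x | C x /\ T x = x].

Definition lipschitz_mapping (alpha : R) : Prop :=
  forall x y, C x -> C y -> mdist (T x) (T y) <= alpha * mdist x y.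

Definition quasi_nonexpansive : Prop :=
  fixed_points !=set0 /\
  forall x q, C x -> fixed_points q -> mdist (T x) q <= mdist x q.

Definition demiclosed : Prop :=
  forall (u : nat -> X) (x : X), (forall k, C (u k)) -> delta_cvg u x ->
    mdist (u k) (T (u k)) @[k --> \oo] --> (0 : R) -> fixed_points x.

(* Since 1 - lam / (1 + lam) = 1 / (1 + lam), the argument of oplus is the
   weight of T y. The default value of xget is never used when C is a closed
   convex subset of a Hadamard space, x is in C, T is alpha-Lipschitz with
   alpha > 1 and 0 < lam < 1 / (alpha - 1): the fixed point exists and is
   unique. *)
Definition resolvent (lam : R) (x : X) : X :=
  xget x [set y | C y /\ y = oplus (lam / (1 + lam)) x (T y)].

End mappings.

(* Main.v *)
(* Write L y = limsup_k d(y, u_k). Comparison with the Euclidean plane gives the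
   CN inequality d(w, (1-t)x (+) ty)^2 <= (1-t) d(w,x)^2 + t d(w,y)^2
   - t(1-t) d(x,y)^2, so L^2 is uniformly convex and every bounded sequence has a
   unique asymptotic center. A diagonal argument extracts from it a subsequence
   all of whose subsequences have the same minimal value of L; these all share
   its center, that is, the subsequence Delta-converges.

   With t = lam_k / (1 + lam_k) and w = q in F(T), the CN inequality and
   quasi-nonexpansiveness give
   d(q, x_{k+1})^2 <= d(q, x_k)^2 - t d(x_k, T x_{k+1})^2, hence
   d(x_k, T x_k) -> 0, and by demiclosedness every Delta-cluster point is in
   F(T).
   For z in F(T) the sequence d(z, x_k) is nonincreasing, so L z is the same
   along all subsequences; two Delta-cluster points are thus minimizers of the
   same L, and coincide. *)

Require Import Defs.
From HB Require Import structures.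
From mathcomp Require Import all_boot all_order all_algebra.
From mathcomp Require Import all_classical all_reals all_analysis.
From mathcomp Require Import ring lra.

Set Implicit Arguments.
Unset Strict Implicit.
Unset Printing Implicit Defensive.

Import Order.TTheory GRing.Theory Num.Theory.
Import numFieldNormedType.Exports.

Local Open Scope classical_set_scope.
Local Open Scope ring_scope.

(** * Comparison triangles and the CN inequality *)

Section cat0.
Context {R : realType}.

Definition plane_point (a b : R) : 'rV[R]_2 :=
  \row_(i < 2) (if i == ord0 then a else b).

Lemma eucl_dist_plane_point (a b c d : R) :
  eucl_dist (plane_point a b) (plane_point c d) =
  Num.sqrt ((a - c) ^+ 2 + (b - d) ^+ 2).
Proof. by rewrite /eucl_dist !big_ord_recl big_ord0 addr0 !mxE. Qed.

(** One side is laid along the horizontal axis, from the origin to [(a, 0)]; the law of cosines then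
    dictates the abscissa [u] of the third vertex. The case [a = 0] is treated apart because that
    formula divides by [a]. *)
Lemma comparison_triangle (a b c : R) : 0 <= a -> 0 <= b -> 0 <= c ->
  a <= b + c -> b <= a + c -> c <= a + b ->
  exists u v : R, u ^+ 2 + v ^+ 2 = b ^+ 2 /\ (u - a) ^+ 2 + v ^+ 2 = c ^+ 2.
Proof.
move=> a0 b0 c0 abc bac cab.
have [az|an0] := eqVneq a 0.
  have bc : b = c by lra.
  by exists b, 0; rewrite az bc; split; ring.
have ap : 0 < a by rewrite lt_neqAle eq_sym an0.
pose u := (a ^+ 2 + b ^+ 2 - c ^+ 2) / (2 * a).
have uE : 2 * a * u = a ^+ 2 + b ^+ 2 - c ^+ 2.
  by rewrite /u; field.
(* [2 * a * (b - u)] is [c ^+ 2 - (a - b) ^+ 2] and [2 * a * (b + u)] is [(a + b) ^+ 2 - c ^+ 2];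
   the triangle inequalities make both nonnegative, so the ordinate is real. *)
have ub : u <= b.
  have : 0 <= 2 * a * (b - u) by rewrite mulrBr uE; nra.
  by rewrite pmulr_rge0 ?subr_ge0//; lra.
have bu : - b <= u.
  have : 0 <= 2 * a * (b + u) by rewrite mulrDr uE; nra.
  by rewrite pmulr_rge0 ?mulr_gt0//; lra.
have v0 : 0 <= b ^+ 2 - u ^+ 2 by nra.
exists u, (Num.sqrt (b ^+ 2 - u ^+ 2)); rewrite sqr_sqrtr//; split; lra.
Qed.

Context {X : metricType R}.
Implicit Types (x y z w : X) (t : R).

Lemma segment_left S x y : geodesic_segment S x y -> S x.
Proof.
move=> [c [c0 _ _] ->]; exists 0 => //=.
by rewrite in_itv/= lexx mdist_ge0.
Qed.

Lemma cat0_CN (S : set X) x y z w t : cat0_space X ->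
  geodesic_segment S x y -> S z -> 0 <= t <= 1 ->
  mdist x z = t * mdist x y ->
  mdist w z ^+ 2 <= (1 - t) * mdist w x ^+ 2 + t * mdist w y ^+ 2
                    - t * (1 - t) * mdist x y ^+ 2.
Proof.
move=> [geoX cat0X] Sxy Sz /andP[t0 t1] xz.
have segm (p q : X) : exists S', geodesic_segment S' p q.
  by have [c cpq] := geoX p q; exists (c @` `[0, mdist p q]); exists c.
have [Syw Syw_seg] := segm y w; have [Swx Swx_seg] := segm w x.
have tri_xy : mdist x y <= mdist w x + mdist y w.
  by rewrite (metric_sym w x) (metric_sym y w); exact: metric_triangle.
have tri_wx : mdist w x <= mdist x y + mdist y w.
  by rewrite (metric_sym w x); exact: metric_triangle.
have tri_yw : mdist y w <= mdist x y + mdist w x.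
  by rewrite (metric_sym w x) (metric_sym x y); exact: metric_triangle.
have [u [v [uvb uvc]]] := comparison_triangle (mdist_ge0 x y) (mdist_ge0 w x)
  (mdist_ge0 y w)
  tri_xy tri_wx tri_yw.
set a := mdist x y in xz uvb uvc *.
have a0 : 0 <= a by exact: mdist_ge0.
pose p' := plane_point 0 0; pose q' := plane_point a 0; pose r' := plane_point u v.
pose z' := plane_point (t * a) 0.
have pq' : eucl_dist p' q' = a.
  by rewrite eucl_dist_plane_point !sub0r oppr0 expr0n addr0 sqrrN sqrtr_sqr ger0_norm.
have qr' : eucl_dist q' r' = mdist y w.
  rewrite eucl_dist_plane_point -[RHS]ger0_norm ?mdist_ge0// -sqrtr_sqr -uvc.
  by congr (Num.sqrt _); ring.
have rp' : eucl_dist r' p' = mdist w x.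
  rewrite eucl_dist_plane_point -[RHS]ger0_norm ?mdist_ge0// -sqrtr_sqr -uvb.
  by congr (Num.sqrt _); ring.
(* The CAT(0) inequality compares points on sides, so the vertex [w] enters as the initial endpoint
   of the side from [w] to [x]. *)
have wr' : comparison_point Swx w x r' p' w r'.
  split => //; first exact: segment_left Swx_seg.
    exists 0; first by rewrite /= in_itv/= lexx ler01.
    by rewrite subr0 scale1r scale0r addr0.
  by rewrite eucl_dist_plane_point !subrr expr0n addr0 sqrtr0 mdistxx.
have zz' : comparison_point S x y p' q' z z'.
  split => //.
    exists t; first by rewrite /= in_itv/= t0.
    by apply/rowP => i; rewrite !mxE; case: ifP => _; ring.
  rewrite eucl_dist_plane_point xz !sub0r oppr0 expr0n addr0 sqrrN sqrtr_sqr.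
  by rewrite ger0_norm// mulr_ge0.
have := cat0X x y w S Syw Swx p' q' r' Sxy Syw_seg Swx_seg pq' qr' rp'
  w z r' z' (Or33 _ _ wr') (Or31 _ _ zz').
rewrite eucl_dist_plane_point.
rewrite -(ler_pXn2r (n := 2))// ?nnegrE ?mdist_ge0 ?sqrtr_ge0//.
rewrite sqr_sqrtr ?addr_ge0 ?sqr_ge0// => /le_trans; apply.
(* In plane coordinates the two sides are equal: this is Stewart's theorem. *)
rewrite (metric_sym w y) -uvc -uvb le_eqVlt; apply/orP; left; apply/eqP; ring.
Qed.

Lemma oplus_spec x y t : cat0_space X -> 0 <= t <= 1 ->
  exists S, [/\ geodesic_segment S x y, S (oplus t x y),
    mdist x (oplus t x y) = t * mdist x y &
    mdist y (oplus t x y) = (1 - t) * mdist x y].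
Proof.
move=> [geoX _] /andP[t0 t1]; rewrite /oplus.
apply: (xgetPex x (P := [set z | exists S, [/\ geodesic_segment S x y, S z,
  mdist x z = t * mdist x y & mdist y z = (1 - t) * mdist x y]])).
have [c cxy] := geoX x y; have [c0 c1 cisom] := cxy.
have d0 := mdist_ge0 x y.
have td : t * mdist x y <= mdist x y by rewrite ler_piMl.
have itd : t * mdist x y \in `[0, mdist x y] by rewrite in_itv/= mulr_ge0.
have it0 : 0 \in `[0, mdist x y] by rewrite in_itv/= lexx.
have it1 : mdist x y \in `[0, mdist x y] by rewrite in_itv/= lexx andbT.
exists (c (t * mdist x y)), (c @` `[0, mdist x y]); split.
- by exists c.
- by exists (t * mdist x y).
- by rewrite -{1}c0 cisom// sub0r normrN ger0_norm// mulr_ge0.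
- by rewrite -{1}c1 cisom// ger0_norm ?subr_ge0//; ring.
Qed.

Lemma oplus_CN x y w t : cat0_space X -> 0 <= t <= 1 ->
  mdist w (oplus t x y) ^+ 2 <= (1 - t) * mdist w x ^+ 2 + t * mdist w y ^+ 2
                                - t * (1 - t) * mdist x y ^+ 2.
Proof.
move=> cX t01; have [S [Sxy Sz xz _]] := oplus_spec x y cX t01.
exact: (cat0_CN _ cX Sxy Sz t01 xz).
Qed.

Lemma oplus_convex (C : set X) x y t : cat0_space X -> geodesic_convex C ->
  0 <= t <= 1 -> C x -> C y -> C (oplus t x y).
Proof.
move=> cX convC t01 Cx Cy; have [S [Sxy Sz _ _]] := oplus_spec x y cX t01.
exact: (convC x y S Cx Cy Sxy).
Qed.

(** The CN inequality is used twice: on [[x, u]] seen from [oplus t x v], then on [[x, v]] seen from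
    [u]. After substitution, everything except [t ^+ 2 * mdist u v ^+ 2] cancels. *)
Lemma oplus_contraction x u v t : cat0_space X -> 0 <= t <= 1 ->
  mdist (oplus t x u) (oplus t x v) <= t * mdist u v.
Proof.
move=> cX t01; have /andP[t0 t1] := t01.
have [_ [_ _ xv _]] := oplus_spec x v cX t01.
have h1 := oplus_CN x u (oplus t x v) cX t01.
have h2 := oplus_CN x v u cX t01.
rewrite metric_sym -(ler_pXn2r (n := 2)) ?nnegrE ?mulr_ge0 ?mdist_ge0//.
move: h1; rewrite (metric_sym _ x) xv (metric_sym _ u) => /le_trans; apply.
have := ler_wpM2l t0 h2; rewrite (metric_sym u x); lra.
Qed.

(** * Minimizers, fixed points and the resolvent *)

Lemma ex_minimizer (C : set X) (g : X -> R) (K : R) : complete_metric X ->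
  closed C -> C !=set0 -> (forall y, C y -> 0 <= g y) ->
  (forall y y', C y -> C y' -> g y <= g y' + K * mdist y y') ->
  (forall e, 0 < e -> exists2 d, 0 < d & forall y y', C y -> C y' ->
    g y <= inf (g @` C) + d -> g y' <= inf (g @` C) + d -> mdist y y' <= e) ->
  exists2 z, C z & forall y, C y -> g z <= g y.
Proof.
move=> complX clC [c0 Cc0] g0 gK gU; set m := inf (g @` C) in gU *.
have hi : has_inf (g @` C).
  by split; [exists (g c0), c0|exists 0 => _ [y Cy <-]; exact: g0].
have mle y : C y -> m <= g y by move=> Cy; apply: ge_inf; [case: hi|exists y].
(* A minimizing sequence: the last hypothesis makes it Cauchy, and the Lipschitz bound carries the
   infimum over to its limit. *)
have /choice[u uP] : forall n : nat, exists y, C y /\ g y < m + n.+1%:R^-1.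
  move=> n; have [|_ [y Cy <-] gy] := inf_adherent (eps := n.+1%:R^-1) _ hi.
    by rewrite invr_gt0.
  by exists y.
have uS (d : R) : 0 < d -> \forall n \near \oo, g (u n) <= m + d.
  move=> dp; near=> n; apply: (le_trans (ltW (uP n).2)); rewrite lerD2l ltW//.
  by near: n; exact: near_infty_natSinv_lt (PosNum dp).
have [z uz] : exists l : X, u @ \oo --> l.
  apply: complX; apply: cauchy_exP => e e0.
  have [d dp dP] := gU (e / 2) (divr_gt0 e0 (ltr0Sn R 1)).
  have [N _ NP] := uS _ dp; exists (u N); exists N => // n /= Nn.
  rewrite ballEmdist/= (le_lt_trans (dP _ _ (uP N).1 (uP n).1 (NP N _) (NP n _)))//=.
  by rewrite ltr_pdivrMr// ltr_pMr// ltr1n.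
have Cz : C z.
  by apply: (closed_cvg (u_ := u) C clC _ z uz); apply: nearW => n; exact: (uP n).1.
exists z => // y Cy; apply: le_trans (mle _ Cy).
apply/ler_addgt0Pr => e e0.
(* [K] has no sign; [|K| + 1] is a positive majorant by which one can divide. *)
have K1 : 0 < `|K| + 1 by rewrite ltr_wpDl.
have e2 : 0 < e / 2 by rewrite divr_gt0.
near \oo => n.
apply: (le_trans (gK z (u n) Cz (uP n).1)).
have gun : g (u n) <= m + e / 2 by near: n; exact: uS.
have dun : mdist z (u n) < e / 2 / (`|K| + 1).
  by near: n; apply: (metricType_numDomainType.cvgr_dist_lt uz); rewrite divr_gt0.
have : K * mdist z (u n) <= e / 2.
  rewrite ltr_pdivlMr// in dun; apply: (le_trans _ (ltW dun)); rewrite mulrC.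
  by rewrite ler_wpM2l ?mdist_ge0// (le_trans (ler_norm K))// lerDl.
lra.
Unshelve. all: by end_near. Qed.

(** The displacement [g y] is minimized over [C]. As [f] shrinks it by the factor [k], its infimum
    is at most 0 and a minimizer has displacement 0; uniformity comes from
    [(1 - k) * mdist y y' <= g y + g y']. *)
Lemma contraction_fixed_point (C : set X) (f : X -> X) (k : R) :
  complete_metric X -> closed C -> C !=set0 -> (forall y, C y -> C (f y)) ->
  0 <= k -> k < 1 ->
  (forall y y', C y -> C y' -> mdist (f y) (f y') <= k * mdist y y') ->
  exists2 z, C z & f z = z.
Proof.
move=> complX clC C0 Cf k0 k1 fk.
pose g y := mdist y (f y).
have gf y : C y -> g (f y) <= k * g y by move=> Cy; exact/fk/Cf.
have g0 y : 0 <= g y by exact: mdist_ge0.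
have lb0 : has_lbound (g @` C) by exists 0 => _ [y _ <-].
have inf0 : inf (g @` C) <= 0.
  rewrite leNgt; apply/negP => m0.
  have hi : has_inf (g @` C) by split; [have [c Cc] := C0; exists (g c), c|].
  have k1m : 0 < (1 - k) * inf (g @` C) by rewrite mulr_gt0 ?subr_gt0.
  have [_ [y Cy <-] gy] := inf_adherent k1m hi.
  have : inf (g @` C) <= g (f y).
    by apply: ge_inf => //; exists (f y); first exact: Cf.
  have := gf _ Cy; have := ler_wpM2l k0 (ltW gy).
  have : 0 < (1 - k) * ((1 - k) * inf (g @` C)) by rewrite mulr_gt0 ?subr_gt0.
  lra.
have [z Cz zmin] : exists2 z, C z & forall y, C y -> g z <= g y.
  apply: (ex_minimizer (K := 1 + k)) => //.
    move=> y y' Cy Cy'; rewrite /g.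
    have := metric_triangle y y' (f y); have := metric_triangle y' (f y') (f y).
    have := fk _ _ Cy' Cy; rewrite (metric_sym y' y); lra.
  move=> e e0; exists (e * (1 - k) / 2) => [|y y' Cy Cy' gy gy'].
    by rewrite divr_gt0// mulr_gt0// subr_gt0.
  have k1p : 0 < 1 - k by rewrite subr_gt0.
  rewrite -(ler_pM2r k1p).
  have := metric_triangle y (f y) y'; have := metric_triangle (f y) (f y') y'.
  have := fk _ _ Cy Cy'; rewrite (metric_sym (f y') y') -/(g y) -/(g y'); lra.
exists z => //; apply/esym/mdist_positivity/eqP.
rewrite eq_le mdist_ge0 andbT.
have := zmin _ (Cf _ Cz); have := gf _ Cz.
have k1p : 0 < 1 - k by rewrite subr_gt0.
by rewrite -(pmulr_rle0 _ k1p) -/(g z) => *; lra.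
Qed.

(** The map defining the resolvent contracts by [lam / (1 + lam) * alpha], and this is below 1
    exactly when [lam * (alpha - 1) < 1]. Hence [xget] returns a genuine fixed point. *)
Lemma resolvent_spec (C : set X) (T : X -> X) (alpha lam : R) x :
  hadamard_space X -> closed C -> geodesic_convex C -> 1 < alpha ->
  (forall y, C y -> C (T y)) -> lipschitz_mapping C T alpha ->
  0 < lam < 1 / (alpha - 1) -> C x ->
  C (resolvent C T lam x) /\
  resolvent C T lam x = oplus (lam / (1 + lam)) x (T (resolvent C T lam x)).
Proof.
move=> [complX cX] clC convC alpha1 CT lipT /andP[lam0 lam1] Cx.
have lam1p : 0 < 1 + lam by lra.
have t0 : 0 <= lam / (1 + lam) by rewrite divr_ge0 ?ltW.
have t1 : lam / (1 + lam) <= 1 by rewrite ler_pdivrMr// mul1r; lra.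
apply: (xgetPex x
  (P := [set y | C y /\ y = oplus (lam / (1 + lam)) x (T y)])).
have [|||||z Cz zE] := @contraction_fixed_point C
    (fun y => oplus (lam / (1 + lam)) x (T y)) (lam / (1 + lam) * alpha) complX clC.
- by exists x.
- by move=> y Cy; apply: oplus_convex => //; [rewrite t0|exact: CT].
- by rewrite mulr_ge0//; lra.
- rewrite mulrAC ltr_pdivrMr// mul1r.
  by move: lam1; rewrite ltr_pdivlMr ?subr_gt0//; lra.
- move=> y y' Cy Cy'; apply: (le_trans (oplus_contraction _ _ _ cX _)).
    by rewrite t0.
  by rewrite -[leRHS]mulrA ler_wpM2l//; exact: lipT.
- by exists z.
Qed.

(** * Asymptotic radii and asymptotic centers *)

Lemma limn_esup_leP (a : nat -> R) (M : R) :
  (limn_esup (EFin \o a) <= M%:E)%E <->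
  forall e, 0 < e -> \forall k \near \oo, a k <= M + e.
Proof.
split=> [aM e e0|aM].
  have /ereal_inf_lt[_ [V Voo <-] supV] : (limn_esup (EFin \o a) < (M + e)%:E)%E.
    by rewrite (le_lt_trans aM)// lte_fin ltrDl.
  apply: filterS Voo => k Vk; rewrite -lee_fin (le_trans _ (ltW supV))//.
  by apply: ereal_sup_ubound; exists k.
apply/lee_addgt0Pr => e e0.
apply: (@le_trans _ _ (ereal_sup [set (a k)%:E | k in [set k | a k <= M + e]])).
  by apply: ereal_inf_lbound; exists [set k | a k <= M + e]; first exact: aM.
by apply: ge_ereal_sup => _ [k ak <-]; rewrite lee_fin.
Qed.

(** Real-valued form of the upper limit minimized by asymptotic centers; for bounded [u] that limit
    is finite, so [fine] loses nothing. *)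
Definition asymptotic_radius (u : nat -> X) y : R :=
  fine (limn_esup (fun k => (mdist y (u k))%:E)).

Section asymptotic_radius.
Variable u : nat -> X.
Hypothesis bu : bounded_sequence u.

Lemma limn_esup_mdist y :
  limn_esup (fun k => (mdist y (u k))%:E) = (asymptotic_radius u y)%:E.
Proof.
have [a [M aM]] := bu; rewrite fineK// ge0_fin_numE.
  apply: (@le_lt_trans _ _ (mdist y a + M)%:E); last exact: ltry.
  apply/limn_esup_leP => e e0; apply: nearW => k.
  apply: (le_trans (metric_triangle y a _)); have := aM k; lra.
by apply: limf_esup_ge0 => // k; rewrite lee_fin mdist_ge0.
Qed.

Lemma asymptotic_radius_leP y M : asymptotic_radius u y <= M <->
  forall e, 0 < e -> \forall k \near \oo, mdist y (u k) <= M + e.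
Proof. by rewrite -lee_fin -limn_esup_mdist; exact: limn_esup_leP. Qed.

Lemma near_asymptotic_radius y e : 0 < e ->
  \forall k \near \oo, mdist y (u k) <= asymptotic_radius u y + e.
Proof. by move: e; apply/asymptotic_radius_leP. Qed.

Lemma asymptotic_radius_le y M :
  (\forall k \near \oo, mdist y (u k) <= M) -> asymptotic_radius u y <= M.
Proof.
move=> uM; apply/asymptotic_radius_leP => e e0.
by apply: filterS uM => k /le_trans; apply; rewrite lerDl ltW.
Qed.

Lemma asymptotic_radius_ge0 y : 0 <= asymptotic_radius u y.
Proof.
apply/ler_addgt0Pr => e e0.
by have [k /(le_trans (mdist_ge0 _ _))] := filter_ex (near_asymptotic_radius y e0).
Qed.

Lemma asymptotic_radius_lipschitz y y' :
  asymptotic_radius u y <= asymptotic_radius u y' + mdist y y'.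
Proof.
apply/asymptotic_radius_leP => e e0.
apply: filterS (near_asymptotic_radius y' e0) => k yk.
have := metric_triangle y y' (u k); lra.
Qed.

(** The CN inequality with [t = 1/2], applied to each term and passed to the upper limit. *)
Lemma asymptotic_radius_midpoint x y : cat0_space X ->
  asymptotic_radius u (oplus 2^-1 x y) ^+ 2 <=
  (asymptotic_radius u x ^+ 2 + asymptotic_radius u y ^+ 2) / 2
  - mdist x y ^+ 2 / 4.
Proof.
move=> cX; set r := asymptotic_radius u; set S := leRHS.
have r0 z : 0 <= r z by exact: asymptotic_radius_ge0.
apply/ler_addgt0Pr => d d0.
have K0 : 0 < r x + r y + 1 by rewrite ltr_wpDl// addr_ge0.
(* Since [e <= 1], enlarging both radii by [e] raises the bound by [e * (r x + r y) + e ^+ 2], which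
   is at most [d]. *)
pose e := Num.min 1 (d / (r x + r y + 1)).
have e0 : 0 < e by rewrite lt_min ltr01 divr_gt0.
have e1 : e <= 1 by rewrite ge_min lexx.
have ed : e * (r x + r y + 1) <= d by rewrite -ler_pdivlMr// ge_min lexx orbT.
have half : 0 <= (2^-1 : R) <= 1 by apply/andP; split; lra.
have mS : \forall k \near \oo, mdist (oplus 2^-1 x y) (u k) ^+ 2 <= S + d.
  near=> k.
  have xk : mdist x (u k) <= r x + e by near: k; exact: near_asymptotic_radius.
  have yk : mdist y (u k) <= r y + e by near: k; exact: near_asymptotic_radius.
  have := oplus_CN x y (u k) cX half.
  rewrite (metric_sym (u k)) => /le_trans; apply.
  have x2 : mdist (u k) x ^+ 2 <= (r x + e) ^+ 2.
    by rewrite lerXn2r ?nnegrE ?mdist_ge0 ?addr_ge0 ?(ltW e0)// metric_sym.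
  have y2 : mdist (u k) y ^+ 2 <= (r y + e) ^+ 2.
    by rewrite lerXn2r ?nnegrE ?mdist_ge0 ?addr_ge0 ?(ltW e0)// metric_sym.
  rewrite /S; nra.
have Sd0 : 0 <= S + d.
  by have [k /(le_trans (sqr_ge0 _))] := filter_ex mS.
rewrite -[leRHS]sqr_sqrtr// lerXn2r ?nnegrE ?sqrtr_ge0//.
apply: asymptotic_radius_le; apply: filterS mS => k mk.
by rewrite -[leLHS]ger0_norm ?mdist_ge0// -sqrtr_sqr ler_wsqrtr.
Unshelve. all: by end_near. Qed.

Lemma asymptotic_centerP x : asymptotic_center u x <->
  forall y, asymptotic_radius u x <= asymptotic_radius u y.
Proof.
by split=> xmin y; have := xmin y; rewrite /= ?limn_esup_mdist lee_fin.
Qed.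

(** If both points have the minimal radius, their midpoint would have a smaller one unless
    [mdist x y = 0]. *)
Lemma asymptotic_center_unique x y : cat0_space X ->
  asymptotic_center u x -> asymptotic_center u y -> x = y.
Proof.
move=> cX /asymptotic_centerP xmin /asymptotic_centerP ymin.
have rxy : asymptotic_radius u y = asymptotic_radius u x.
  by apply/le_anti; rewrite xmin ymin.
have := asymptotic_radius_midpoint x y cX; rewrite rxy.
have := xmin (oplus 2^-1 x y); have := asymptotic_radius_ge0 x => r0 rm.
have : asymptotic_radius u x ^+ 2 <= asymptotic_radius u (oplus 2^-1 x y) ^+ 2.
  by rewrite lerXn2r ?nnegrE ?asymptotic_radius_ge0.
move=> h1 h2; apply/mdist_positivity/eqP; rewrite -sqrf_eq0.
by rewrite eq_le sqr_ge0 andbT; lra.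
Qed.

Lemma ex_asymptotic_center :
  hadamard_space X -> exists z, asymptotic_center u = [set z].
Proof.
move=> [complX cX]; set r := asymptotic_radius u.
have r0 z : 0 <= r z by exact: asymptotic_radius_ge0.
have rinf z : inf (r @` setT) <= r z.
  by apply: ge_inf; [exists 0 => _ [y _ <-]|exists z].
have m0 : 0 <= inf (r @` setT).
  by apply: lb_le_inf; [exists (r (u 0%N)), (u 0%N)|move=> _ [y _ <-]].
have [|||||z _ zmin] := @ex_minimizer setT r 1 complX.
- exact: closedT.
- by exists (u 0%N).
- by [].
- by move=> y y' _ _; rewrite mul1r; exact: asymptotic_radius_lipschitz.
- move=> e e0; set m := inf _ in rinf m0 *.
  have K0 : 0 < 8 * m + 4 by lra.
  (* The midpoint inequality bounds [mdist y y' ^+ 2] by [4 * ((m + d) ^+ 2 - m ^+ 2)], hence by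
     [d * (8 * m + 4)] as [d <= 1]. *)
  pose d := Num.min 1 (e ^+ 2 / (8 * m + 4)).
  have d0 : 0 < d by rewrite lt_min ltr01 divr_gt0// exprn_gt0.
  have d1 : d <= 1 by rewrite ge_min lexx.
  have ed : d * (8 * m + 4) <= e ^+ 2 by rewrite -ler_pdivlMr// ge_min lexx orbT.
  have md0 : 0 <= m + d by lra.
  exists d => // y y' _ _ ym ym'.
  have := asymptotic_radius_midpoint y y' cX; rewrite -/r => mid.
  have mm : m ^+ 2 <= r (oplus 2^-1 y y') ^+ 2 by rewrite lerXn2r ?nnegrE.
  have ry : r y ^+ 2 <= (m + d) ^+ 2 by rewrite lerXn2r ?nnegrE.
  have ry' : r y' ^+ 2 <= (m + d) ^+ 2 by rewrite lerXn2r ?nnegrE.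
  rewrite -(ler_pXn2r (n := 2)) ?nnegrE ?mdist_ge0 ?(ltW e0)//; nra.
exists z; apply/seteqP; split => [y yc|_ ->].
  rewrite /=; apply: (asymptotic_center_unique cX yc); apply/asymptotic_centerP => w.
  exact: zmin.
by apply/asymptotic_centerP => w; exact: zmin.
Qed.

End asymptotic_radius.
End cat0.

(** * Extractions and the diagonal argument *)

Section subsequences.

Local Notation extraction phi := {homo phi : m n / (m < n)%N}.

Lemma extraction_geq (phi : nat -> nat) : extraction phi -> forall n, (n <= phi n)%N.
Proof. by move=> hphi; elim=> // n /leq_ltn_trans; apply; exact: hphi. Qed.

Lemma near_extraction (phi : nat -> nat) (P : nat -> Prop) : extraction phi ->
  (\forall k \near \oo, P k) -> \forall k \near \oo, P (phi k).
Proof.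
move=> hphi [N _ NP]; exists N => // k /= Nk; apply: NP => /=.
exact: leq_trans Nk (extraction_geq hphi k).
Qed.

Lemma ler_add_invS (R : realType) (a b : R) :
  (forall n : nat, a <= b + n.+1%:R^-1) -> a <= b.
Proof.
move=> ab; apply/ler_addgt0Pr => e e0; near \oo => n.
apply: (le_trans (ab n)); rewrite lerD2l ltW//.
by near: n; exact: near_infty_natSinv_lt (PosNum e0).
Unshelve. all: by end_near. Qed.

(* Diagonal argument: F at phis n.+1 is within 1/(n+1) of its infimum over all
   further subsequences, and the diagonal w and w \o psi are both eventually
   such subsequences. *)
Lemma regular_extraction (R : realType) (F : (nat -> nat) -> R) :
  (forall phi, 0 <= F phi) ->
  (forall phi psi, extraction phi -> extraction psi ->
    (\forall k \near \oo, range phi (psi k)) -> F psi <= F phi) ->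
  exists2 phi, extraction phi &
    forall psi, extraction psi -> F (phi \o psi) = F phi.
Proof.
move=> F0 Fle.
pose near_inf (n : nat) (phi : nat -> nat) :=
  forall psi, extraction psi -> (\forall k \near \oo, range phi (psi k)) ->
    F phi <= F psi + n.+1%:R^-1.
have /choice[step stepP] : forall p : nat * (nat -> nat), exists phi',
    extraction p.2 ->
    [/\ extraction phi', range phi' `<=` range p.2 & near_inf p.1 phi'].
  move=> [n phi] /=; have [hphi|nphi] := pselect (extraction phi);
    last by exists phi.
  pose E := [set F psi | psi in [set psi : nat -> nat |
    extraction psi /\ range psi `<=` range phi]].
  have lbE : has_lbound E by exists 0 => _ [psi _ <-].
  have hE : has_inf E.
    by split=> //; exists (F phi), phi => //; split=> //; exact: subset_refl.
  have n0 : 0 < n.+1%:R^-1 :> R by rewrite invr_gt0.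
  have [_ [phi' [hphi' sub'] <-] Fphi'] := inf_adherent n0 hE.
  exists phi' => _; split=> // psi hpsi [N _ Npsi].
  apply: (le_trans (ltW Fphi')); rewrite lerD2r.
  (* [psi] lies in the range of [phi'] only eventually; dropping its first [N] terms yields a
     competitor in [E] without increasing [F]. *)
  have hshift : extraction (fun k => psi (N + k)%N).
    by move=> i j ij; apply: hpsi; rewrite ltn_add2l.
  apply: (@le_trans _ _ (F (fun k => psi (N + k)%N))).
    apply: ge_inf => //; exists (fun k => psi (N + k)%N) => //; split=> //.
    by move=> _ [k _ <-]; apply/sub'/Npsi => /=; exact: leq_addr.
  by apply: Fle => //; apply: nearW => k; exists (N + k)%N.
pose phis := fix phis n := if n is m.+1 then step (m, phis m) else id.
have hphis n : extraction (phis n).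
  by elim: n => // n hn; have [] := stepP (n, phis n) hn.
have stepphis n := stepP (n, phis n) (hphis n).
have subphis m n : (m <= n)%N -> range (phis n) `<=` range (phis m).
  move=> /subnKC <-; elim: (n - m)%N => [|k IH]; first by rewrite addn0.
  rewrite addnS; apply: subset_trans IH.
  by have [] := stepphis (m + k)%N.
(* An extraction dominates the identity, so evaluating [phis j.+1] at [(w j).+1] gives a value above
   [w j]. *)
pose w := fix w k := if k is j.+1 then phis j.+1 (w j).+1 else phis 0%N 0%N.
have hw : extraction w.
  apply: homo_ltn; first by move=> ? ? ?; exact: ltn_trans.
  by move=> i; exact: (extraction_geq (hphis i.+1) (w i).+1).
have wphis k : range (phis k) (w k).
  by case: k => [|k]; [exists 0%N|exists (w k).+1].
have near_w psi n : extraction psi ->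
    \forall k \near \oo, range (phis n) ((w \o psi) k).
  move=> hpsi; exists n => // k /= nk; apply: subphis (wphis _).
  exact: leq_trans nk (extraction_geq hpsi k).
exists w => // psi hpsi.
have hwpsi : extraction (w \o psi) by move=> i j /hpsi /hw.
have hid : extraction (@id nat) by [].
(* Each of [F w] and [F (w \o psi)] is at most [F (phis n.+1)], which exceeds the other by at most
   [1/(n+1)]. *)
apply/le_anti/andP; split; apply: ler_add_invS => n;
  have [_ _ inf_n] := stepphis n.
  apply: (@le_trans _ _ (F (phis n.+1)));
    first exact: Fle _ _ (hphis _) hwpsi (near_w _ _ hpsi).
  exact: (inf_n _ hw (near_w id n.+1 hid)).
apply: (@le_trans _ _ (F (phis n.+1)));
  first exact: Fle _ _ (hphis _) hw (near_w _ _ hid).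
exact: (inf_n _ hwpsi (near_w psi n.+1 hpsi)).
Qed.

(** * Delta-convergent subsequences and Fejer monotonicity *)

Context {R : realType} {X : metricType R}.
Implicit Types (u : nat -> X) (phi psi : nat -> nat).

Lemma bounded_comp u phi : bounded_sequence u -> bounded_sequence (u \o phi).
Proof. by move=> [a [M aM]]; exists a, M => k; exact: aM. Qed.

(** Stated for eventual inclusion of ranges, as the diagonal argument requires. If [psi k = phi j]
    and [k >= phi N], then [phi j >= phi N], so [j >= N]. *)
Lemma asymptotic_radius_sub u phi psi (y : X) : bounded_sequence u ->
  extraction phi -> extraction psi -> (\forall k \near \oo, range phi (psi k)) ->
  asymptotic_radius (u \o psi) y <= asymptotic_radius (u \o phi) y.
Proof.
move=> bu hphi hpsi phipsi; apply/(asymptotic_radius_leP (bounded_comp _ bu)) => e e0.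
have [N _ NP] := near_asymptotic_radius (bounded_comp phi bu) y e0.
near=> k.
have [j _ jk] : range phi (psi k) by near: k.
rewrite /= -jk; apply: NP => /=; rewrite leqNgt; apply/negP => /hphi.
rewrite jk ltnNge => /negP; apply; apply: leq_trans (extraction_geq hpsi k).
by near: k; exact: nbhs_infty_ge.
Unshelve. all: by end_near. Qed.

Lemma asymptotic_radius_comp u phi (y : X) : bounded_sequence u ->
  extraction phi -> asymptotic_radius (u \o phi) y <= asymptotic_radius u y.
Proof.
move=> bu hphi; apply: (@asymptotic_radius_sub u id) => //.
by apply: nearW => k; exists (phi k).
Qed.

Lemma ex_delta_cvg_subsequence u : hadamard_space X -> bounded_sequence u ->
  exists2 phi, extraction phi & exists z, delta_cvg (u \o phi) z.
Proof.
move=> hX bu; pose F phi := inf (range (asymptotic_radius (u \o phi))).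
have buphi phi := bounded_comp phi bu.
have lbF phi : has_lbound (range (asymptotic_radius (u \o phi))).
  by exists 0 => _ [y _ <-]; exact: asymptotic_radius_ge0.
have neF phi : range (asymptotic_radius (u \o phi)) !=set0.
  by exists (asymptotic_radius (u \o phi) (u 0%N)), (u 0%N).
have Fle phi y : F phi <= asymptotic_radius (u \o phi) y.
  by apply: ge_inf => //; exists y.
have [||phi hphi Fphi] := regular_extraction (F := F).
- by move=> phi; apply: lb_le_inf => // _ [y _ <-]; exact: asymptotic_radius_ge0.
- move=> phi psi hphi hpsi sub; apply: lb_le_inf => // _ [y _ <-].
  exact: le_trans (Fle _ y) (asymptotic_radius_sub _ bu hphi hpsi sub).
have [z zE] := ex_asymptotic_center (buphi phi) hX.
have zc : asymptotic_center (u \o phi) z by rewrite zE.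
have zF : asymptotic_radius (u \o phi) z = F phi.
  apply/le_anti; rewrite Fle andbT; apply: lb_le_inf => // _ [y _ <-].
  by move/(asymptotic_centerP (buphi phi)): zc.
exists phi => //; exists z; split=> // psi hpsi.
have buc : bounded_sequence ((u \o phi) \o psi) by exact: bounded_comp.
(* Along [psi] the radius of [z] cannot grow, while the infimum of the radii stays [F phi]; so [z]
   remains a minimizer. *)
have zpsi : asymptotic_center ((u \o phi) \o psi) z.
  apply/(asymptotic_centerP buc) => y.
  apply: (le_trans (asymptotic_radius_comp z (buphi phi) hpsi)).
  by rewrite zF -(Fphi _ hpsi); exact: Fle.
have [_ cX] := hX.
apply/seteqP; split => [y yc|_ ->//].
exact: (asymptotic_center_unique buc cX yc zpsi).
Qed.

Lemma fejer_delta_cvg (S : set X) u : hadamard_space X -> S !=set0 ->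
  (forall q k, S q -> mdist q (u k.+1) <= mdist q (u k)) ->
  (forall phi z, extraction phi -> delta_cvg (u \o phi) z -> S z) ->
  exists2 q, S q & delta_cvg u q.
Proof.
move=> hX [q0 Sq0] fejer cluster; have [_ cX] := hX.
have mono q m n : S q -> (m <= n)%N -> mdist q (u n) <= mdist q (u m).
  move=> Sq /subnKC <-; elim: (n - m)%N => [|k IH]; first by rewrite addn0.
  by rewrite addnS; exact: le_trans (fejer _ _ Sq) IH.
have bu : bounded_sequence u by exists q0, (mdist q0 (u 0%N)) => k; exact: mono.
have radE q phi : S q -> extraction phi ->
    asymptotic_radius (u \o phi) q = asymptotic_radius u q.
  move=> Sq hphi; apply/le_anti; rewrite asymptotic_radius_comp//=.
  apply/(asymptotic_radius_leP bu) => e e0.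
  have [k qk] := filter_ex (near_asymptotic_radius (bounded_comp phi bu) q e0).
  (* By monotonicity a single term close to the radius bounds all later distances. *)
  by exists (phi k) => // n /= kn; exact: le_trans (mono _ _ _ Sq kn) qk.
have [phi hphi [z uz]] := ex_delta_cvg_subsequence hX bu.
have Sz : S z by exact: cluster uz.
exists z => //; split=> // psi hpsi.
have bupsi := bounded_comp psi bu.
have [psi' hpsi' [z' uz']] := ex_delta_cvg_subsequence hX bupsi.
have hcomp : extraction (psi \o psi') by move=> i j /hpsi' /hpsi.
have Sz' : S z' by exact: cluster (psi \o psi') z' hcomp uz'.
have center (v : nat -> X) y : delta_cvg v y -> asymptotic_center v y.
  by move=> [_ /(_ id)] => ->.
have bucomp := bounded_comp (psi \o psi') bu.
(* Radii at [z] and [z'] are the same along every subsequence, so the minimality of [z] along [phi]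
   lets it match the minimizer [z'] along [psi \o psi']. *)
have zc' : asymptotic_center (u \o (psi \o psi')) z.
  apply/(asymptotic_centerP bucomp) => y.
  apply: (@le_trans _ _ (asymptotic_radius (u \o (psi \o psi')) z')); last first.
    by apply/(asymptotic_centerP bucomp): y; exact: center.
  rewrite !radE// -(radE z phi)// -(radE z' phi)//.
  by move/(asymptotic_centerP (bounded_comp phi bu)): (center _ _ uz).
(* Going back from [psi \o psi'] to [psi] keeps the radius of [z] and can only raise the others. *)
have zc : asymptotic_center (u \o psi) z.
  apply/(asymptotic_centerP bupsi) => y.
  rewrite radE// -(radE z (psi \o psi'))//.
  apply: le_trans (asymptotic_radius_comp y bupsi hpsi').
  by move/(asymptotic_centerP bucomp): zc'.
apply/seteqP; split => [y yc|_ ->//].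
exact: (asymptotic_center_unique bupsi cX yc zc).
Qed.

End subsequences.

(** * The resolvent iteration *)

Lemma limn_einf_gt0 (R : realType) (a : nat -> R) :
  (0 < limn_einf (fun k => (a k)%:E))%E ->
  exists2 c, 0 < c & \forall k \near \oo, c <= a k.
Proof.
rewrite /limn_einf oppe_gt0 => supN.
have [c c0 supc] : exists2 c : R, 0 < c &
    (limn_esup (EFin \o (fun k => - a k)%R) <= (- c)%:E)%E.
  rewrite -[EFin \o _]/(fun k => (- (a k)%:E)%E).
  (* If the lower limit is infinite, any positive constant works, here 1. *)
  move: supN; case: limn_esup => [r|//|_]; last by exists 1; rewrite ?leNye.
  by rewrite lte_fin => r0; exists (- r); rewrite ?oppr_gt0// opprK.
exists (c / 2); first by rewrite divr_gt0.
have c2 : 0 < c / 2 by rewrite divr_gt0.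
by move/limn_esup_leP: supc => /(_ _ c2); apply: filterS => k /=; lra.
Qed.

Lemma nonincreasing_diff_small (R : realType) (a : nat -> R) (e : R) :
  (forall k, 0 <= a k) -> (forall k, a k.+1 <= a k) -> 0 < e ->
  \forall k \near \oo, a k - a k.+1 < e.
Proof.
move=> a0 adec e0.
have amono : nonincreasing_seq a by exact/nonincreasing_seqP.
have lba : has_lbound (range a) by exists 0 => _ [k _ <-].
have [_ [N _ <-] aN] : exists2 y, range a y & y < inf (range a) + e.
  by apply: inf_adherent => //; split => //; exists (a 0%N), 0%N.
exists N => // k /= Nk.
have := ge_inf lba (imageP a (I : [set: nat] k.+1)); have := amono _ _ Nk; lra.
Qed.

(** The CN inequality is implicit here: bounding [mdist q (T y)] by [mdist q y] puts [y] on both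
    sides, and one divides by [1 - t]. The second bound comes from
    [mdist y (T y) = (1 - t) * mdist x (T y)]. *)
Lemma quasi_nonexpansive_step (R : realType) (X : metricType R) (T : X -> X)
    (t : R) (x y q : X) :
  cat0_space X -> 0 <= t < 1 -> y = oplus t x (T y) ->
  mdist (T y) q <= mdist y q ->
  mdist q y ^+ 2 <= mdist q x ^+ 2 - t * mdist x (T y) ^+ 2 /\
  mdist y (T y) <= mdist x (T y).
Proof.
move=> cX /andP[t0 t1] yE Tyq.
have t01 : 0 <= t <= 1 by rewrite t0 ltW.
have t1p : 0 < 1 - t by rewrite subr_gt0.
split.
  have := oplus_CN x (T y) q cX t01; rewrite -yE.
  have : mdist q (T y) ^+ 2 <= mdist q y ^+ 2.
    by rewrite lerXn2r ?nnegrE ?mdist_ge0// metric_sym (metric_sym q).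
  move=> /(ler_wpM2l t0) h1 h2; rewrite -(ler_pM2l t1p); lra.
have [_ [_ _ _]] := oplus_spec x (T y) cX t01.
rewrite -yE metric_sym => ->.
by rewrite ler_piMl ?mdist_ge0//; lra.
Qed.

Theorem corollary3p18 (R : realType) (X : metricType R) (C : set X)
    (alpha : R) (T : X -> X) (lam : nat -> R) (x : nat -> X) :
  hadamard_space X ->
  closed C -> geodesic_convex C ->
  1 < alpha ->
  (forall y, C y -> C (T y)) ->
  lipschitz_mapping C T alpha ->
  demiclosed C T ->
  quasi_nonexpansive C T ->
  (forall k, 0 < lam k < 1 / (alpha - 1)) ->
  (0 < limn_einf (fun k => (lam k)%:E))%E ->
  C (x 0%N) ->
  (forall k, x k.+1 = resolvent C T (lam k) (x k)) ->
  exists2 q, fixed_points C T q & delta_cvg x q.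
Proof.
move=> hX clC convC alpha1 CT lipT demiT [[q0 Fq0] qneT] lamP lam_inf Cx0 xS.
have [_ cX] := hX.
pose t k := lam k / (1 + lam k).
have lam0 k : 0 < lam k by have /andP[] := lamP k.
have lam1p k : 0 < 1 + lam k by rewrite addr_gt0.
have t01 k : 0 <= t k < 1.
  by rewrite divr_ge0 ?ltW//= ltr_pdivrMr// mul1r; lra.
have Cx k : C (x k).
  elim: k => // k Cxk; rewrite xS.
  by have [] := resolvent_spec hX clC convC alpha1 CT lipT (lamP k) Cxk.
have xE k : x k.+1 = oplus (t k) (x k) (T (x k.+1)).
  rewrite xS.
  by have [] := resolvent_spec hX clC convC alpha1 CT lipT (lamP k) (Cx k).
have step q k : fixed_points C T q ->
    mdist q (x k.+1) ^+ 2 <=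
      mdist q (x k) ^+ 2 - t k * mdist (x k) (T (x k.+1)) ^+ 2 /\
    mdist (x k.+1) (T (x k.+1)) <= mdist (x k) (T (x k.+1)).
  move=> Fq; apply: (quasi_nonexpansive_step cX (t01 k) (xE k)).
  exact: qneT (Cx _) Fq.
have fejer q k : fixed_points C T q -> mdist q (x k.+1) <= mdist q (x k).
  move=> Fq; rewrite -(ler_pXn2r (n := 2)) ?nnegrE ?mdist_ge0//.
  apply: (le_trans (step q k Fq).1); rewrite gerBl mulr_ge0 ?sqr_ge0//.
  by have /andP[] := t01 k.
have xT : mdist (x k) (T (x k)) @[k --> \oo] --> (0 : R).
  apply/cvgrPdist_lt => e e0.
  have [c c0 clam] := limn_einf_gt0 lam_inf.
  have c1 : 0 < c / (1 + c) by rewrite divr_gt0// addr_gt0.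
  have ce : 0 < c / (1 + c) * e ^+ 2 by rewrite mulr_gt0// exprn_gt0.
  have sqr_dec k : mdist q0 (x k.+1) ^+ 2 <= mdist q0 (x k) ^+ 2.
    by rewrite lerXn2r ?nnegrE ?mdist_ge0// fejer.
  have small := nonincreasing_diff_small (a := fun k => mdist q0 (x k) ^+ 2)
    (fun k => sqr_ge0 _) sqr_dec ce.
  have : \forall k \near \oo, mdist (x k.+1) (T (x k.+1)) < e.
    near=> k; have [h1 h2] := step q0 k Fq0.
    have clk : c <= lam k by near: k.
    have hs : mdist q0 (x k) ^+ 2 - mdist q0 (x k.+1) ^+ 2 < c / (1 + c) * e ^+ 2.
      by near: k.
    (* [s / (1 + s)] increases with [s], so the lower bound on [lam k] passes to [t k]. *)
    have ct : c / (1 + c) <= t k.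
      by rewrite ler_pdivlMr// mulrAC ler_pdivrMr ?addr_gt0//; lra.
    apply: (le_lt_trans h2).
    rewrite -(ltr_pXn2r (n := 2)) ?nnegrE ?mdist_ge0 ?ltW//.
    rewrite -(ltr_pM2l c1); apply: le_lt_trans hs.
    have := ler_wpM2r (sqr_ge0 (mdist (x k) (T (x k.+1)))) ct; lra.
  (* The estimate concerns [x k.+1], hence the threshold [N.+1] for [x k]. *)
  move=> [N _ NP]; exists N.+1 => // -[//|k] /= Nk.
  by rewrite sub0r normrN ger0_norm ?mdist_ge0//; exact: NP.
apply: (fejer_delta_cvg hX) => //; first by exists q0.
move=> phi z hphi xz; apply: (demiT (x \o phi) z) => //.
  by move=> k; exact: Cx.
apply/cvgrPdist_lt => e e0.
apply: (near_extraction hphi (P := fun k => `|0 - mdist (x k) (T (x k))| < e)).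
by move/cvgrPdist_lt: xT => /(_ _ e0).
Unshelve. all: by end_near. Qed.
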